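(* Let $\mathcal{F} = \{123,145,167,246,257,347,356,1,2,3,4,5,6,7,\emptyset\}\subseteq 2^{[7]}$. There is no collection of open convex sets $U_1,\dots,U_7\subseteq\mathbb{R}^3$ realizing $\mathcal{F}$. That is, $\mathrm{odim}(\mathcal{F})\ge 4$.
   Context: Codewords are written by listing elements, e.g. $123=\{1,2,3\}$. A collection $\{U_1,\dots,U_n\}$ of subsets of $\mathbb{R}^d$ realizes a code $\mathcal{C}\subseteq 2^{[n]}$ if $\mathcal{C}=\{\sigma\subseteq[n]:\exists p\in\mathbb{R}^d,\ p\in U_i\iff i\in\sigma\}$. $\mathrm{odim}(\mathcal{C})$ is the minimum $d$ such that $\mathcal{C}$ is realized by open convex subsets of $\mathbb{R}^d$ (or $\infty$ if none exists). *)

(* Defs.v *)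
From HB Require Import structures.
From mathcomp Require Import all_boot all_order all_algebra.
From mathcomp Require Import all_classical all_reals all_analysis.
Import Order.TTheory GRing.Theory Num.Theory numFieldNormedType.Exports.

Set Implicit Arguments.
Unset Strict Implicit.
Unset Printing Implicit Defensive.

(* A code on n neurons is a [{set {set 'I_n}}]: the neuron written i in
   {1, ..., n} is the ordinal with value i - 1. *)

Definition realizes (R : realType) (n d : nat) (U : 'I_n -> set 'rV[R]_d)
    (C : {set {set 'I_n}}) : Prop :=
  forall s : {set 'I_n},
    s \in C <-> exists p : 'rV[R]_d, forall i : 'I_n, U i p <-> i \in s.

Definition open_convex_realizable (R : realType) (n : nat)
    (C : {set {set 'I_n}}) (d : nat) : Prop :=
  exists U : 'I_n -> set 'rV[R]_d,
    (forall i, open (U i) /\ convex_set (U i)) /\ realizes U C.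

(* As the dimensions are natural numbers, this infimum is a minimum, unless C
   has no open convex realization, in which case it is [+oo]. *)
Definition odim (R : realType) (n : nat) (C : {set {set 'I_n}}) : \bar R :=
  ereal_inf [set (d%:R)%:E | d in [set d | open_convex_realizable R C d]]%classic.

Lemma odim_min (R : realType) (n : nat) (C : {set {set 'I_n}}) (d : nat) :
  open_convex_realizable R C d ->
  (forall e, open_convex_realizable R C e -> d <= e) ->
  odim R C = (d%:R)%:E.
Proof.
move=> Cd dmin; apply/le_anti/andP; split.
  by apply: ereal_inf_lbound; exists d.
by apply: le_ereal_inf_tmp => _ [e Ce <-]; rewrite lee_fin ler_nat dmin.
Qed.

Lemma odim_infty (R : realType) (n : nat) (C : {set {set 'I_n}}) :
  (forall d, ~ open_convex_realizable R C d) -> odim R C = +oo%E.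
Proof.
move=> Cn; rewrite -[+oo%E]ereal_inf0; congr ereal_inf.
by rewrite -subset0 => x [d Cd _]; exact: (Cn d Cd).
Qed.

Definition codeword (n : nat) (w : seq nat) : {set 'I_n} :=
  [set i : 'I_n | (i : nat).+1 \in w]%SET.

Definition Fano_words : seq (seq nat) :=
  [:: [:: 1; 2; 3]; [:: 1; 4; 5]; [:: 1; 6; 7]; [:: 2; 4; 6]; [:: 2; 5; 7];
      [:: 3; 4; 7]; [:: 3; 5; 6];
      [:: 1]; [:: 2]; [:: 3]; [:: 4]; [:: 5]; [:: 6]; [:: 7]; [::]].

Definition Fano_code : {set {set 'I_7}} :=
  [set:: [seq codeword 7 w | w <- Fano_words]]%SET.

(* Main.v *)
Require Import Defs.
From mathcomp Require Import all_boot all_order all_algebra.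
From mathcomp Require Import all_classical all_reals all_analysis.
From mathcomp Require Import ring lra.
Import numFieldNormedType.Exports.
Import Order.TTheory GRing.Theory Num.Theory.

Local Open Scope ring_scope.
Local Open Scope classical_set_scope.

(* For every line {i, j, k} the sets U_i, U_j, U_k pairwise meet exactly in their
   common part, which forces conv (U_j `|` U_k) to meet U_i only in that part.
   Choose a point in the region of each of the seven lines.  Given lines a, b
   through i, let {i, j, k} be the third line through i: the segment [x_a, x_b]
   lies in U_i and the other five points lie in U_j or U_k.  If the segment met
   their hull, it would do so at a point v of the region of {i, j, k}; with j' on
   a, k' on b and i' on {i, j, k} collinear, v is a point of U_i' between U_j'
   and U_k', hence in U_j' as well, which no codeword allows.  So an affine
   dependence among the seven points never splits into at most two coefficients
   of one sign against the rest, whereas Radon's theorem yields such a splitting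
   for any five points in dimension at most 3. *)

(** * Convex combinations, the sunflower lemma, affine dependences *)

Section Geometry.
Context {R : realType}.

Lemma convex_comb {E : lmodType R} {A : set E} {a b : R} {x y : E} :
  convex_set A -> A x -> A y -> 0 <= a -> 0 <= b -> a + b = 1 ->
  A (a *: x + b *: y).
Proof.
move=> cA Ax Ay a0 b0 ab; have a1 : a <= 1 by rewrite -ab lerDl.
have := cA x y (Itv01 a0 a1) (mem_set Ax) (mem_set Ay).
move/set_mem; congr (A _).
have -> : b = 1 - a by rewrite -ab [a + b]addrC addrK.
by [].
Qed.

Lemma convex_cone_add {E : lmodType R} {A : set E} {a b : R} {x y : E} :
  convex_set A -> A x -> A y -> 0 <= a -> 0 <= b ->
  exists2 z, A z & a *: x + b *: y = (a + b) *: z.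
Proof.
move=> cA Ax Ay a0 b0; have [ab0|ab0] := eqVneq (a + b) 0.
  exists x => //; have [-> ->] : a = 0 /\ b = 0 by split; lra.
  by rewrite addr0 !scale0r addr0.
have ab_gt0 : 0 < a + b by rewrite lt_neqAle eq_sym ab0 addr_ge0.
exists ((a / (a + b)) *: x + (b / (a + b)) *: y).
  apply: convex_comb => //; rewrite ?divr_ge0 ?addr_ge0//.
  by rewrite -mulrDl divff.
by rewrite scalerDr !scalerA !(mulrC (a + b)) !divfK.
Qed.

(** Unnormalised weights make the claim additive: [convex_cone_add] merges the [A]-parts and the
    [B]-parts separately, and nonemptiness supplies a point for a part of weight zero. *)
Lemma sum_convex_join {E : lmodType R} {A B : set E} {I : Type} (r : seq I)
    (P : pred I) (c : I -> R) (x : I -> E) :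
  convex_set A -> convex_set B -> A !=set0 -> B !=set0 ->
  (forall i, P i -> 0 <= c i) -> (forall i, P i -> A (x i) \/ B (x i)) ->
  exists a b y z, [/\ 0 <= a /\ 0 <= b, A y, B z,
    \sum_(i <- r | P i) c i = a + b &
    \sum_(i <- r | P i) c i *: x i = a *: y + b *: z].
Proof.
move=> cA cB [y0 Ay0] [z0 Bz0] c0 ABx.
apply: (big_ind2 (fun s u => exists a b y z, [/\ 0 <= a /\ 0 <= b, A y, B z,
    s = a + b & u = a *: y + b *: z])).
- by exists 0, 0, y0, z0; split; rewrite ?addr0// !scale0r addr0.
- move=> _ _ _ _ [a1 [b1 [y1 [z1 [[a10 b10] Ay1 Bz1 -> ->]]]]]
    [a2 [b2 [y2 [z2 [[a20 b20] Ay2 Bz2 -> ->]]]]].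
  have [y Ay yE] := convex_cone_add cA Ay1 Ay2 a10 a20.
  have [z Bz zE] := convex_cone_add cB Bz1 Bz2 b10 b20.
  exists (a1 + a2), (b1 + b2), y, z; split=> //.
  + by split; apply: addr_ge0.
  + by rewrite addrACA.
  + by rewrite -yE -zE addrACA.
- move=> i Pi; case: (ABx i Pi) => [Axi|Bxi].
  + exists (c i), 0, (x i), z0; split; rewrite ?addr0 ?scale0r ?addr0//.
    by split=> //; apply: c0.
  + exists 0, (c i), y0, (x i); split; rewrite ?add0r ?scale0r ?add0r//.
    by split=> //; apply: c0.
Qed.

Lemma open_absorb2 {E : normedModType R} {A : set E} {x : E} (u w : E) :
  open A -> A x ->
  exists2 e, 0 < e &
    forall a b, `|a| < e -> `|b| < e -> A (x + a *: u + b *: w).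
Proof.
move=> oA Ax; have /nbhs_normP[r /= r0 rA] := open_nbhs_nbhs (conj oA Ax).
(* The summand 1 keeps [M] positive when [u] and [w] vanish, and makes the final bound strict. *)
pose M := `|u| + `|w| + 1.
have M0 : 0 < M by rewrite ltr_wpDl ?addr_ge0.
exists (r / M); first by rewrite divr_gt0.
move=> a b ar br; apply: rA => /=.
rewrite -addrA opprD addrA subrr sub0r normrN.
apply: (le_lt_trans (ler_normD _ _)); rewrite !normrZ.
rewrite -[ltRHS](divfK (lt0r_neq0 M0)) /M !mulrDr mulr1.
have rM : 0 < r / M by rewrite divr_gt0.
by rewrite ltr_pwDr// lerD// ler_wpM2r// ltW.
Qed.

(* Let w = z - p with p in the centre, and let t0 be the exit time of the ray
   p + t w from the centre.  The homothety of ratio t0 centred at p puts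
   q = p + t0 w on a segment [x', y'] with x' in B, y' in C.  Pushing x', y'
   forward by h w and pulling them towards a point of the centre close to q
   gives points of B and of C so close to q that they lie in A, hence in the
   centre, and the segment between them meets the ray beyond q. *)
Lemma sunflower_join {E : normedModType R} {A B C : set E} {a b : R} {x y : E} :
  open A -> convex_set A -> open B -> convex_set B -> open C -> convex_set C ->
  A `&` B `<=` C -> A `&` C `<=` B -> A `&` B `&` C !=set0 ->
  B x -> C y -> 0 <= a -> 0 <= b -> a + b = 1 ->
  A (a *: x + b *: y) -> B (a *: x + b *: y).
Proof.
move=> oA cA oB cB oC cC ABC ACB [p [[Ap Bp] Cp]] Bx Cy a0 b0 ab.
set z := a *: x + b *: y => Az.
apply: contrapT => nBz.
pose w := z - p.
have wz t : p + t *: w = (1 - t) *: p + t *: z.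
  by rewrite /w scalerBr scalerBl scale1r addrAC addrA.
(* Membership in [B] describes the centre here: up to time 1 the ray stays in [A], and [A] meets [B]
   only inside [C]. *)
pose S := [set t : R | 0 <= t /\ B (p + t *: w)].
have S0 : S 0 by split; rewrite // scale0r addr0.
have ubS : ubound S 1.
  move=> t [t0 Bt]; rewrite leNgt; apply/negP => t1; apply: nBz.
  have -> : z = (1 - t^-1) *: p + t^-1 *: (p + t *: w).
    rewrite scalerDr addrA -scalerDl subrK scale1r scalerA mulVf ?lt0r_neq0//; last lra.
    by rewrite scale1r /w addrC subrK.
  by apply: convex_comb; rewrite // ?invr_ge0// ?subrK// subr_ge0 invf_le1 ?ltW//; lra.
have supS : has_sup S by split; [exists 0|exists 1].
pose t0 := sup S.
have t00 : 0 <= t0 by apply: ub_le_sup => //; exists 1.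
have t01 : t0 <= 1 by apply: ge_sup => //; exists 0.
pose q := p + t0 *: w.
have Aq : A q by rewrite /q wz; apply: convex_comb; rewrite ?subrK// subr_ge0.
pose x' := p + t0 *: (x - p); pose y' := p + t0 *: (y - p).
have hom (D : set E) v : convex_set D -> D p -> D v -> D (p + t0 *: (v - p)).
  move=> cD Dp Dv; have -> : p + t0 *: (v - p) = (1 - t0) *: p + t0 *: v.
    by rewrite scalerBr scalerBl scale1r addrAC addrA.
  by apply: convex_comb; rewrite ?subrK// subr_ge0.
have Bx' : B x' by exact: hom.
have Cy' : C y' by exact: hom.
have qE : q = a *: x' + b *: y'.
  rewrite /q /x' /y' /w /z !scalerDr addrACA -scalerDl ab scale1r; congr (_ + _).
  rewrite !scalerA ![t0 * _]mulrC !scalerN addrACA -opprD; congr (_ + _ - _).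
  by rewrite -!scalerA -scalerDl ab scale1r.
have [e1 e10 HB] := open_absorb2 w w oB Bx'.
have [e2 e20 HC] := open_absorb2 w w oC Cy'.
pose h := Num.min e1 e2 / 2.
have m0 : 0 < Num.min e1 e2 by rewrite lt_min e10.
have h0 : 0 < h by rewrite divr_gt0.
have hm : h < Num.min e1 e2 by rewrite /h; lra.
have Bxh : B (x' + h *: w).
  have := HB 0 h; rewrite scale0r addr0 normr0 gtr0_norm//; apply=> //.
  by apply: (lt_le_trans hm); rewrite ge_min lexx.
have Cyh : C (y' + h *: w).
  have := HC 0 h; rewrite scale0r addr0 normr0 gtr0_norm//; apply=> //.
  by apply: (lt_le_trans hm); rewrite ge_min lexx orbT.
have [e3 e30 HAx] := open_absorb2 (x' + h *: w - q) w oA Aq.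
have [e4 e40 HAy] := open_absorb2 (y' + h *: w - q) w oA Aq.
(* The cap at 1 gives [d < 1], so that [1 - d] and [d] are weights of a convex combination. *)
pose e := Num.min (Num.min e3 e4) 1; pose d := e / 2.
have e0 : 0 < e by rewrite !lt_min e30 e40/=.
have d0 : 0 < d by rewrite divr_gt0.
have de : d < e by rewrite /d; lra.
have e1' : e <= 1 by rewrite /e ge_min lexx orbT.
have ee3 : e <= e3 by rewrite /e !ge_min lexx.
have ee4 : e <= e4 by rewrite /e !ge_min lexx orbT.
(* The bound [d] on [t0 - t] keeps the pulled points close to [q]; the bound [d * h] makes the final
   parameter [t0 + d * h - (1 - d) * (t0 - t)] exceed [t0]. *)
have [||t [tge0 Bt] tt0] := @sup_adherent _ S (Num.min (d * h) d) => //.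
  by rewrite lt_min d0 mulr_gt0.
have [tdh td] : t0 - t < d * h /\ t0 - t < d.
  move: tt0; rewrite -/t0 ltrBlDr addrC -ltrBlDr => tt0.
  by split; apply: (lt_le_trans tt0); rewrite ge_min lexx ?orbT.
have tt : t <= t0 by apply: ub_le_sup => //; exists 1.
have At : A (p + t *: w).
  by rewrite wz; apply: convex_comb; rewrite ?subrK// subr_ge0; lra.
pose s := (1 - d) * (t - t0).
have sd : `|s| < d.
  rewrite /s normrM [`|t - _|]ler0_norm ?subr_le0// ger0_norm ?subr_ge0; last lra.
  nra.
have comb v : (1 - d) *: (p + t *: w) + d *: v = q + d *: (v - q) + s *: w.
  have -> : p + t *: w = q + (t - t0) *: w.
    by rewrite /q scalerBl -addrA [t0 *: w + _]addrC subrK.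
  rewrite scalerDr scalerA -/s scalerBl scale1r [d *: (v - q)]scalerBr.
  by rewrite [LHS]addrAC addrA [q + d *: v - _]addrAC.
have toA (D : set E) v : convex_set D -> D (p + t *: w) -> D v ->
    (forall a b, `|a| < e -> `|b| < e -> A (q + a *: (v - q) + b *: w)) ->
    A ((1 - d) *: (p + t *: w) + d *: v) /\ D ((1 - d) *: (p + t *: w) + d *: v).
  move=> cD Dt Dv HA; split.
    by rewrite comb; apply: HA; rewrite ?(gtr0_norm d0)//; apply: lt_trans de.
  by apply: convex_comb; rewrite ?subrK ?subr_ge0//; lra.
have Ct : C (p + t *: w) by apply: ABC; split.
have [Af Bf] := toA B _ cB Bt Bxh (fun a b ha hb =>
  HAx a b (lt_le_trans ha ee3) (lt_le_trans hb ee3)).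
have [Ag Cg] := toA C _ cC Ct Cyh (fun a b ha hb =>
  HAy a b (lt_le_trans ha ee4) (lt_le_trans hb ee4)).
have := convex_comb cB Bf (ACB _ (conj Ag Cg)) a0 b0 ab.
have mix u v v' : a *: (u + v) + b *: (u + v') = u + (a *: v + b *: v').
  by rewrite !scalerDr addrACA -scalerDl ab scale1r.
have mixZ u v : a *: (d *: u) + b *: (d *: v) = d *: (a *: u + b *: v).
  by rewrite scalerDr !scalerA ![d * _]mulrC.
rewrite mix mixZ [x' + _]addrC [y' + _]addrC mix -qE.
have -> : (1 - d) *: (p + t *: w) + d *: (h *: w + q) =
          p + ((1 - d) * t + d * (t0 + h)) *: w.
  rewrite /q; clearbody w; rewrite [h *: w + _]addrCA !scalerDr addrACA.
  rewrite -scalerDl subrK scale1r; congr (_ + _).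
  by rewrite !scalerA -!scalerDl mulrDr [d * h + _]addrC.
move=> Bnew.
have : (1 - d) * t + d * (t0 + h) <= t0.
  by apply: ub_le_sup; [exists 1|split=> //; nra].
nra.
Qed.

(** The [n] rows [(1, x m)] live in dimension [d + 1 < n], hence are linearly dependent. Extending
    [l] by zero lets the dependence be read among more points later. *)
Lemma affine_dependence (n d : nat) (x : nat -> 'rV[R]_d) : (d.+1 < n)%N ->
  exists l : nat -> R, [/\ exists2 m, (m < n)%N & l m != 0,
    forall m, (n <= m)%N -> l m = 0,
    \sum_(m < n) l m = 0 & \sum_(m < n) l m *: x m = 0].
Proof.
move=> dn; pose M : 'M[R]_(n, 1 + d) :=
  row_mx (const_mx 1) (\matrix_(m < n) x m).
have : kermx M != 0.
  rewrite kermx_eq0 -row_leq_rank -ltnNge.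
  by apply: leq_ltn_trans (rank_leq_col _) _.
move=> /rowV0Pn[v /sub_kermxP vM v0].
exists (fun m => oapp (v 0) 0 (insub m)); split.
- have /matrix0Pn[i [j vj]] : v != 0 by [].
  by exists j => //; rewrite valK/= -(ord1 i).
- by move=> m nm; rewrite insubF// ltnNge nm.
- move: vM; rewrite mul_mx_row => /(congr1 (lsubmx)); rewrite row_mxKl.
  move=> /matrixP/(_ 0 0); rewrite !mxE => vE.
  rewrite -[RHS]vE; apply: eq_bigr => m _; by rewrite valK mxE mulr1.
- move: vM; rewrite mul_mx_row => /(congr1 (rsubmx)); rewrite row_mxKr.
  rewrite mulmx_sum_row linear0 => vE; rewrite -[RHS]vE.
  by apply: eq_bigr => m _; rewrite valK rowK.
Qed.

End Geometry.

(** * Incidences of the Fano plane *)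

Definition collinear (t : nat * nat * nat) : bool :=
  let: (i, j, k) := t in
  uniq [:: i; j; k] && has (fun w => all [in w] [:: i; j; k]) Fano_words.

(** Each line occurs in all six orders, so that its points can take any roles. *)
Definition triples : seq (nat * nat * nat) :=
  [seq t <- [seq (ij, k) | ij <- [seq (i, j) | i <- iota 1 7, j <- iota 1 7],
                           k <- iota 1 7] | collinear t].

(** Only the indices below 7 give lines, as [Fano_words] lists these first. *)
Definition line (m : nat) : seq nat := nth [::] Fano_words m.

Lemma triples_word {i j k : nat} {w : seq nat} :
  (i, j, k) \in triples -> w \in Fano_words ->
  [/\ i \in w -> j \in w -> k \in w, i \in w -> k \in w -> j \in w
    & j \in w -> k \in w -> i \in w].
Proof.
move=> F wF.
have : all (fun t => all (fun w : seq nat => [&&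
    [&& t.1.1 \in w & t.1.2 \in w] ==> (t.2 \in w),
    [&& t.1.1 \in w & t.2 \in w] ==> (t.1.2 \in w)
  & [&& t.1.2 \in w & t.2 \in w] ==> (t.1.1 \in w)]) Fano_words) triples.
  by vm_compute.
move=> /allP/(_ _ F); cbv beta => /allP/(_ _ wF)/and3P[/implyP ijk /implyP ikj /implyP jki].
by split=> p q; [apply: ijk|apply: ikj|apply: jki]; apply/andP.
Qed.

Lemma triples_iota {i j k : nat} : (i, j, k) \in triples ->
  [/\ i \in iota 1 7, j \in iota 1 7 & k \in iota 1 7].
Proof.
have : all (fun t => [&& t.1.1 \in iota 1 7, t.1.2 \in iota 1 7 & t.2 \in iota 1 7])
  triples by vm_compute.
by move=> /allP/[apply]/= /and3P.
Qed.

Lemma triples_line {i j k : nat} : (i, j, k) \in triples ->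
  exists m, [/\ i \in line m, j \in line m & k \in line m].
Proof.
have : all (fun t => has (fun m => [&& t.1.1 \in line m, t.1.2 \in line m
  & t.2 \in line m]) (iota 0 7)) triples by vm_compute.
by move=> /allP/[apply]/hasP[m _ /and3P]; exists m.
Qed.

(** Here [i] is the common point of the two lines and [{i, j, k}] is the third line through it. The
    four lines that miss [i] must meet that third line in [j] or [k]. *)
Lemma line_pair (a b : nat) : (a < 7)%N -> (b < 7)%N -> a != b ->
  exists i j k i' j' k', [/\ (i, j, k) \in triples, (i', j', k') \in triples,
    [/\ i \in line a, i \in line b, j' \in line a, k' \in line b &
       i' \in [:: i; j; k]],
    forall m, (m < 7)%N -> m != a -> m != b -> (j \in line m) || (k \in line m)
  & forall w, w \in Fano_words -> ~~ all [in w] [:: i; j; j']].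
Proof.
pose T a b t t' := [&& t.1.1 \in line a, t.1.1 \in line b, t'.1.2 \in line a,
  t'.2 \in line b, t'.1.1 \in [:: t.1.1; t.1.2; t.2],
  all (fun m => [|| m == a, m == b, t.1.2 \in line m | t.2 \in line m]) (iota 0 7)
  & all (fun w => ~~ all [in w] [:: t.1.1; t.1.2; t'.1.2]) Fano_words].
move=> a7 b7 ab.
have : all (fun a => all (fun b => (a == b) || has (fun t => has (T a b t) triples) triples)
         (iota 0 7)) (iota 0 7) by vm_compute.
move=> /allP/(_ a); rewrite mem_iota => /(_ a7)/allP/(_ b).
rewrite mem_iota (negPf ab) => /(_ b7)/hasP[[[i j] k] tF].
move=> /hasP[[[i' j'] k'] tF' /and5P[ia ib ja kb /and3P[iijk m7 wF]]].
exists i, j, k, i', j', k'; split => // [m mlt ma mb|w].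
  by have := allP m7 m; rewrite mem_iota (negPf ma) (negPf mb) => /(_ mlt).
exact: (allP wF w).
Qed.

(* Either the true or the false values number at most two; the indices 5 and 6
   pad them to exactly two. *)
Lemma sign_pair (s : nat -> bool) : exists c a b,
  [/\ (a < 7)%N, (b < 7)%N, a != b,
    forall m, (m < 5)%N -> m != a -> m != b -> s m = ~~ c
  & forall m, (m < 5)%N -> (m == a) || (m == b) -> s m = c].
Proof.
have : has (fun c => has (fun a => has (fun b => (a != b) &&
    all (fun m => s m == (((m == a) || (m == b)) == c)) (iota 0 5))
    (iota 0 7)) (iota 0 7)) [:: true; false].
  rewrite /=; case: (s 0); case: (s 1); case: (s 2); case: (s 3); case: (s 4);
  by vm_compute.
move=> /hasP[c _ /hasP[a a7 /hasP[b b7 /andP[ab /allP sm]]]].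
rewrite !mem_iota in a7 b7.
exists c, a, b; split => // m m5.
  move=> /negPf ma /negPf mb; have := sm m; rewrite mem_iota m5 => /(_ isT)/eqP->.
  by rewrite ma mb; case: (c).
move=> mab; have := sm m; rewrite mem_iota m5 => /(_ isT)/eqP->.
by rewrite mab; case: (c).
Qed.

(** * Open convex sets with the Fano code *)

Section FanoArrangement.
Context {R : realType} {E : normedModType R}.
Variables (U : nat -> set E) (x : nat -> E).
Hypothesis oU : forall n, open (U n).
Hypothesis cU : forall n, convex_set (U n).
Hypothesis codeU : forall p, exists2 w, w \in Fano_words &
  forall n, n \in iota 1 7 -> U n p <-> n \in w.
Hypothesis lineU : forall m n, n \in line m -> U n (x m).

Lemma U_triple {i j k : nat} {p : E} : (i, j, k) \in triples ->
  [/\ U i p -> U j p -> U k p, U i p -> U k p -> U j p & U j p -> U k p -> U i p].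
Proof.
move=> F; have [w wF wU] := codeU p; have [i7 j7 k7] := triples_iota F.
have [ijk ikj jki] := triples_word F wF.
by split=> /wU-/(_ _) Hp /wU-/(_ _) Hq; apply/wU => //;
  [apply: ijk|apply: ikj|apply: jki]; auto.
Qed.

Lemma U_join {i j k : nat} {a b : R} {y z : E} : (i, j, k) \in triples ->
  U j y -> U k z -> 0 <= a -> 0 <= b -> a + b = 1 ->
  U i (a *: y + b *: z) -> U j (a *: y + b *: z) /\ U k (a *: y + b *: z).
Proof.
move=> F Uy Uz a0 b0 ab Ui; set v := a *: y + b *: z in Ui *.
suff Uj : U j v by split=> //; have [+ _ _] := @U_triple _ _ _ v F; apply.
apply: (@sunflower_join _ _ (U i) _ (U k)) => //.
- by move=> p [Ui' Uj']; have [+ _ _] := @U_triple _ _ _ p F; apply.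
- by move=> p [Ui' Uj']; have [_ + _] := @U_triple _ _ _ p F; apply.
- by have [m [? ? ?]] := triples_line F; exists (x m); do 2?split; apply: lineU.
Qed.

(** If [l a + l b] is zero, all coefficients vanish by their signs. Otherwise dividing by it gives a
    point of the segment from [x a] to [x b] in the hull of the other five points, which is
    impossible. *)
Lemma dependence_trivial (a b : nat) (l : nat -> R) :
  (a < 7)%N -> (b < 7)%N -> a != b -> 0 <= l a -> 0 <= l b ->
  (forall m, (m < 7)%N -> m != a -> m != b -> l m <= 0) ->
  \sum_(m < 7) l m = 0 -> \sum_(m < 7) l m *: x m = 0 ->
  forall m, (m < 7)%N -> l m = 0.
Proof.
move=> a7 b7 ab la lb lneg.
have ba : Ordinal b7 != Ordinal a7 by rewrite -val_eqE eq_sym.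
pose P (i : 'I_7) := (i != Ordinal a7) && (i != Ordinal b7).
rewrite (bigD1 (Ordinal a7))//= (bigD1 (Ordinal b7))//=.
rewrite [in X in _ -> X](bigD1 (Ordinal a7))//= [in X in _ -> X](bigD1 (Ordinal b7))//=.
rewrite !addrA => /eqP; rewrite addr_eq0 -sumrN => /eqP sl.
move=> /eqP; rewrite addr_eq0 -sumrN => /eqP slx.
have lP i : P i -> 0 <= - l i.
  by move=> /andP[ia ib]; rewrite oppr_ge0; apply: lneg => //; rewrite -val_eqE in ia ib.
have [T0|T0] := eqVneq (l a + l b) 0.
  have la0 : l a = 0 by lra.
  have lb0 : l b = 0 by lra.
  move: sl; rewrite T0 => /esym/psumr_eq0P => /(_ lP) lz m m7.
  have [->//|ma] := eqVneq m a; have [->//|mb] := eqVneq m b.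
  by apply/eqP; rewrite -oppr_eq0; apply/eqP/(lz (Ordinal m7)); rewrite /P -!val_eqE/= ma mb.
exfalso.
have Tgt0 : 0 < l a + l b by rewrite lt_neqAle eq_sym T0 addr_ge0.
have [i [j [k [i' [j' [k' [F F' [ia ib ja kb iijk] jkm nw]]]]]]] := line_pair a b a7 b7 ab.
have [m0 [im0 jm0 km0]] := triples_line F.
have [||//||c [d [y [z [[c0 d0] Uy Uz cd]]]]] := @sum_convex_join _ _ (U j) (U k) _
   (index_enum 'I_7) P (fun i => - l i) x (cU j) (cU k).
- by exists (x m0); apply: lineU.
- by exists (x m0); apply: lineU.
- move=> m /andP[ma mb]; have /orP[] := jkm m (ltn_ord m) ma mb.
    by left; apply: lineU.
  by right; apply: lineU.
rewrite (eq_bigr (fun i : 'I_7 => - (l i *: x i))) => [slx'|m _]; last by rewrite scaleNr.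
rewrite slx' in slx; rewrite cd in sl.
set T := l a + l b in sl T0 Tgt0.
pose v := (l a / T) *: x a + (l b / T) *: x b.
have nT (f : R) : 0 <= f -> 0 <= f / T by move=> f0; rewrite divr_ge0// ltW.
have vE : v = (c / T) *: y + (d / T) *: z.
  by rewrite /v ![_ / T]mulrC -!scalerA -!scalerDr slx.
have lT1 : l a / T + l b / T = 1 by rewrite -mulrDl divff.
have cT1 : c / T + d / T = 1 by rewrite -mulrDl -sl divff.
have Ui : U i v by apply: convex_comb; rewrite ?nT//; apply: lineU.
have [Uj Uk] : U j v /\ U k v.
  by rewrite vE; apply: (U_join F); rewrite ?nT// -vE.
have Ui' : U i' v by move: iijk; rewrite !inE => /or3P[]/eqP->.
(* The same [v], now seen as a combination of [x a] in [U j'] and [x b] in [U k']. *)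
have [Uj' _] := U_join F' (lineU a j' ja) (lineU b k' kb) (nT _ la) (nT _ lb) lT1 Ui'.
have [w wF wU] := codeU v.
have [i7 j7 _] := triples_iota F; have [_ j7' _] := triples_iota F'.
have /negP := nw w wF; apply; rewrite /= andbT; apply/and3P.
by split; apply/wU.
Qed.

End FanoArrangement.

(** * Radon's argument in dimension at most three *)

Lemma Fano_not_realizable (R : realType) (d : nat) : (d < 4)%N ->
  ~ open_convex_realizable R Fano_code d.
Proof.
move=> d4 [U [ocU realU]].
(* Neuron [n] is the ordinal [n - 1]. Outside 1 to 7 the default of [inord] still yields an open
   convex set. *)
pose V n := U (inord n.-1).
have val7 n : n \in iota 1 7 -> (inord n.-1 : 'I_7).+1 = n.
  by rewrite mem_iota; case: n => [//|n] /= n7; rewrite inordK.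
have mem_code (s : {set 'I_7}) : reflect (exists2 w, w \in Fano_words & s = codeword 7 w)
    (s \in Fano_code).
  by rewrite /Fano_code inE; apply: mapP.
have codeV p : exists2 w, w \in Fano_words &
    forall n, n \in iota 1 7 -> V n p <-> n \in w.
  have : [set i | `[< U i p >]]%SET \in Fano_code.
    by apply/realU; exists p => i; rewrite inE; split=> /asboolP.
  move=> /mem_code[w wF] /setP sE; exists w => // n n7.
  have := sE (inord n.-1); rewrite !inE val7// => <-.
  by split=> /asboolP.
have /choice[x lineV] : forall m, exists p : 'rV[R]_d, forall n, n \in line m -> V n p.
  move=> m.
  have [m15|m15] := ltnP m (size Fano_words); last first.
    by exists 0 => n; rewrite /line nth_default.
  have wF : line m \in Fano_words by apply: mem_nth.
  have /realU[p pU] : codeword 7 (line m) \in Fano_code by apply/mem_code; exists (line m).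
  exists p => n nm; apply/pU; rewrite inE val7//.
  have : all (fun w => all [in iota 1 7] w) Fano_words by vm_compute.
  by move=> /allP/(_ _ wF); cbv beta => /allP/(_ _ nm).
(* Five points exceed [d + 1], and one of the two sign classes among five coefficients has at most
   two members. *)
have [l [[m m5 lm] l0 sl slx]] := @affine_dependence R 5 d x d4.
have [c [a [b [a7 b7 ab sF sT]]]] := sign_pair (fun m => 0 < l m).
(* This sign turns the dependence so that [a] and [b] carry the nonnegative coefficients. *)
pose e : R := (-1) ^+ ~~ c.
pose L m := e * l m.
have e0 : e != 0 by rewrite signr_eq0.
have Lsign n : (n < 7)%N -> if (n == a) || (n == b) then 0 <= L n else L n <= 0.
  move=> n7; rewrite /L /e; have [n5|n5] := ltnP n 5; last by rewrite l0// mulr0; case: ifP.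
  case: ifPn => [nab|].
    have := sT n n5 nab; case: (c) => /=; rewrite ?expr0 ?expr1 ?mul1r ?mulN1r ?oppr_ge0.
      exact: ltW.
    by move=> /negbT; rewrite leNgt.
  rewrite negb_or => /andP[na nb]; have := sF n n5 na nb.
  case: (c) => /=; rewrite ?expr0 ?expr1 ?mul1r ?mulN1r ?oppr_le0.
    by move=> /negbT; rewrite leNgt.
  exact: ltW.
have L0 n : (5 <= n)%N -> L n = 0 by move=> n5; rewrite /L l0// mulr0.
have : L m = 0.
  apply: (dependence_trivial V x (fun n => (ocU _).1) (fun n => (ocU _).2)
    codeV lineV a b L a7 b7 ab).
  - by have := Lsign a a7; rewrite eqxx.
  - by have := Lsign b b7; rewrite eqxx orbT.
  - by move=> n n7 /negPf na /negPf nb; have := Lsign n n7; rewrite na nb.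
  (* The terms 5 and 6 vanish, which leaves the sum over five points. *)
  - rewrite 2!big_ord_recr/= !L0// !addr0 -mulr_sumr.
    by rewrite sl mulr0.
  - rewrite 2!big_ord_recr/= !L0// !scale0r !addr0.
    under eq_bigr do rewrite -scalerA.
    by rewrite -scaler_sumr slx scaler0.
  - exact: ltn_trans m5 _.
by move/eqP; rewrite mulf_eq0 (negPf e0) (negPf lm).
Qed.

Theorem theorem4p1 (R : realType) :
  (~ exists U : 'I_7 -> set 'rV[R]_3,
       (forall i, open (U i) /\ convex_set (U i)) /\ realizes U Fano_code)
  /\ (4%:E <= odim R Fano_code)%E.
Proof.
split; first exact: (@Fano_not_realizable R 3).
apply: le_ereal_inf_tmp => _ [d Cd <-]; rewrite lee_fin ler_nat leqNgt.
by apply/negP => d4; exact: Fano_not_realizable d4 Cd.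
Qed.
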